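(* Let $\{\mathbb{X}_n\}_{n\in\mathbb{N}}$ be a sequence of non-trivial normed linear spaces over $\mathbb{K}$. (i) For non-zero $x=\{x_n\}_{n\in\mathbb{N}}\in\bigoplus_1\mathbb{X}_n$, $$D(x)=\begin{cases}\sup_{n\in\mathbb{N}}D(x_n),&\text{if }x_n\neq0\text{ for every }n\in\mathbb{N},\\2,&\text{otherwise.}\end{cases}$$ (ii) For non-zero $x=\{x_n\}_{n\in\mathbb{N}}\in\bigoplus_0\mathbb{X}_n$, $$D(x)=\begin{cases}D(x_n),&\text{if there is an }n\in\mathbb{N}\text{ such that }\|x_k\|=\|x\|_0\text{ if and only if }k=n,\\2,&\text{otherwise.}\end{cases}$$
   Context: $\mathbb{K}=\mathbb{R}$ or $\mathbb{C}$; non-trivial means of dimension more than $0$. $\bigoplus_1\mathbb{X}_n$ and $\bigoplus_0\mathbb{X}_n$ are the spaces of sequences $\{x_n\}$, $x_n\in\mathbb{X}_n$, with respectively $\sum_n\|x_n\|<\infty$ and $\lim_n\|x_n\|=0$, normed by $\|\{x_n\}\|_1=\sum_n\|x_n\|$ and $\|\{x_n\}\|_0=\max_n\|x_n\|$. For a non-zero $x$ in a normed space $\mathbb{X}$, $J(x)=\{f\in\mathbb{X}^*:\|f\|=1,\ f(x)=\|x\|\}$ and $D(x)=\operatorname{diam}(J(x))$ (diameter in the norm of $\mathbb{X}^*$). *)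

(* Defs.v *)
From HB Require Import structures.
From mathcomp Require Import all_boot all_order all_algebra.
From mathcomp.real_closed Require Import complex.
From mathcomp Require Import all_classical all_reals all_analysis.

Set Implicit Arguments.
Unset Strict Implicit.
Unset Printing Implicit Defensive.

Import Order.TTheory GRing.Theory Num.Theory.
Import numFieldNormedType.Exports.

Local Open Scope classical_set_scope.
Local Open Scope ring_scope.

Variant scalar_kind := RealScalars | ComplexScalars.

Definition scalars (R : realType) (F : scalar_kind) : numFieldType :=
  match F with
  | RealScalars => R
  | ComplexScalars => complex.complex R
  end.

(* The norm of a [normedModType K] is [K]-valued, hence for [K = R[i]] a
   nonnegative real number embedded in [R[i]]; [realpart] and [of_real] go back
   and forth between such norms and [R], where suprema and sums are taken. *)
Definition realpart (R : realType) (F : scalar_kind) : scalars R F -> R :=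
  match F with
  | RealScalars => fun a => a
  | ComplexScalars => fun a => complex.Re a
  end.

Definition of_real (R : realType) (F : scalar_kind) : R -> scalars R F :=
  match F with
  | RealScalars => fun a => a
  | ComplexScalars => fun a => complex.Complex a 0
  end.
Arguments of_real {R} F.

Section scalars_theory.
Context {R : realType} (F : scalar_kind).
Implicit Types a b : R.

Lemma of_realK : cancel (of_real F) (@realpart R F).
Proof. by case: F. Qed.

Lemma of_realD a b : of_real F (a + b) = of_real F a + of_real F b.
Proof. by case: F => //=; apply/eqP; rewrite complex.eq_complex /= addr0 !eqxx. Qed.

Lemma of_realM a b : of_real F (a * b) = of_real F a * of_real F b.
Proof.
case: F => //=; apply/eqP; rewrite complex.eq_complex /=.
by rewrite !mulr0 mul0r subr0 addr0 !eqxx.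
Qed.

Lemma ler_of_real a b : (of_real F a <= of_real F b) = (a <= b).
Proof. by case: F => //=; rewrite complex.lecE /= eqxx. Qed.

Lemma ge0_realpartK (z : scalars R F) : 0 <= z -> of_real F (realpart z) = z.
Proof.
move: z; case: F => //= -[u v]; rewrite complex.lecE /= => /andP[/eqP ->].
by [].
Qed.

End scalars_theory.

Section real_norm.
Context {R : realType} {F : scalar_kind}.
Local Notation K := (scalars R F).

Definition rnorm {V : normedModType K} (v : V) : R := realpart `|v|.

Context {V : normedModType K}.
Implicit Types u v : V.

Lemma rnormE v : of_real F (rnorm v) = `|v|.
Proof. exact/ge0_realpartK/normr_ge0. Qed.

Lemma rnorm_ge0 v : 0 <= rnorm v.
Proof.
rewrite -(ler_of_real F) rnormE.
by rewrite (_ : of_real F 0 = 0) ?normr_ge0//; case: F.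
Qed.

Lemma rnorm0 : rnorm (0 : V) = 0.
Proof. by rewrite /rnorm normr0; case: F. Qed.

Lemma rnorm0_eq0 v : rnorm v = 0 -> v = 0.
Proof.
move=> v0; apply/eqP; rewrite -normr_eq0 -rnormE v0.
by case: (F).
Qed.

Lemma ler_rnormD u v : rnorm (u + v) <= rnorm u + rnorm v.
Proof. by rewrite -(ler_of_real F) of_realD !rnormE ler_normD. Qed.

Lemma rnormZ (l : K) v : rnorm (l *: v) = realpart `|l| * rnorm v.
Proof.
apply: (can_inj (@of_realK R F)).
by rewrite of_realM !rnormE ge0_realpartK// normrZ.
Qed.

End real_norm.

Section duality.
Context {R : realType} {F : scalar_kind} {X : normedModType (scalars R F)}.
Local Notation K := (scalars R F).

Definition dual_space : set (X -> K^o) :=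
  [set f | linear f /\ continuous f].

Definition dual_norm (f : X -> K^o) : R :=
  sup [set rnorm (f y) | y in [set y : X | rnorm y <= 1]].

Definition dual_diam (A : set (X -> K^o)) : R :=
  sup [set dual_norm (f - g) | f in A & g in A].

Definition J (x : X) : set (X -> K^o) :=
  [set f | [/\ dual_space f, dual_norm f = 1 & f x = `|x|]].

Definition D (x : X) : R := dual_diam (J x).

End duality.

Section vector_sequences.
Context {R : realType} {F : scalar_kind}.
Local Notation K := (scalars R F).
Variable X : nat -> normedModType K.

Definition vseq : Type := forall n, X n.
Identity Coercion vseq_fun : vseq >-> Funclass.

HB.instance Definition _ := gen_eqMixin vseq.
HB.instance Definition _ := gen_choiceMixin vseq.

Implicit Types x y z : vseq.

Definition vseq_zero : vseq := fun=> 0.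
Definition vseq_add x y : vseq := fun n => x n + y n.
Definition vseq_opp x : vseq := fun n => - x n.
Definition vseq_scale (a : K) x : vseq := fun n => a *: x n.

Fact vseq_addA : associative vseq_add.
Proof. by move=> x y z; apply: functional_extensionality_dep => n; exact: addrA. Qed.
Fact vseq_addC : commutative vseq_add.
Proof. by move=> x y; apply: functional_extensionality_dep => n; exact: addrC. Qed.
Fact vseq_add0 : left_id vseq_zero vseq_add.
Proof. by move=> x; apply: functional_extensionality_dep => n; exact: add0r. Qed.
Fact vseq_addN : left_inverse vseq_zero vseq_opp vseq_add.
Proof. by move=> x; apply: functional_extensionality_dep => n; exact: addNr. Qed.

HB.instance Definition _ :=
  GRing.isZmodule.Build vseq vseq_addA vseq_addC vseq_add0 vseq_addN.

Fact vseq_scaleA a b x : vseq_scale a (vseq_scale b x) = vseq_scale (a * b) x.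
Proof. by apply: functional_extensionality_dep => n; exact: scalerA. Qed.
Fact vseq_scale1 : left_id 1 vseq_scale.
Proof. by move=> x; apply: functional_extensionality_dep => n; exact: scale1r. Qed.
Fact vseq_scaleDr : right_distributive vseq_scale +%R.
Proof. by move=> a x y; apply: functional_extensionality_dep => n; exact: scalerDr. Qed.
Fact vseq_scaleDl x : {morph vseq_scale^~ x : a b / a + b}.
Proof. by move=> a b; apply: functional_extensionality_dep => n; exact: scalerDl. Qed.

HB.instance Definition _ := GRing.Zmodule_isLmodule.Build K vseq
  vseq_scaleA vseq_scale1 vseq_scaleDr vseq_scaleDl.

Definition norms x : R^nat := fun n => rnorm (x n).

Definition in_l1 : {pred vseq} := [pred x | `[< cvgn (series (norms x)) >]].

Definition in_c0 : {pred vseq} := [pred x | `[< norms x @ \oo --> (0 : R) >]].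

Lemma cvg_norms_dominated x (v : R^nat) : (forall n, norms x n <= v n) ->
  cvgn (series v) -> cvgn (series (norms x)).
Proof.
move=> le_xv; apply: series_le_cvg => //= n; first exact: rnorm_ge0.
exact: le_trans (rnorm_ge0 _) (le_xv n).
Qed.

Lemma norms0_dominated x (v : R^nat) : (forall n, norms x n <= v n) ->
  v @ \oo --> (0 : R) -> norms x @ \oo --> (0 : R).
Proof.
move=> le_xv v0; apply: squeeze_cvgr (@cvg_cst _ _ _ _ _) v0.
by apply: nearW => n /=; rewrite rnorm_ge0 le_xv.
Qed.

Lemma norms_lincomb (a : K) x y n :
  norms (a *: x + y) n <= realpart `|a| * norms x n + norms y n.
Proof. by rewrite -rnormZ; exact: ler_rnormD. Qed.

Lemma norms_zero : norms 0 = cst 0.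
Proof. by apply/funext => n; exact: rnorm0. Qed.

Fact in_l1_submod : submod_closed in_l1.
Proof.
split=> [|a x y /asboolP cx /asboolP cy]; apply/asboolP.
  rewrite norms_zero; apply: (cvgP (0 : R)).
  rewrite (_ : series _ = cst 0); first exact: cvg_cst.
  by apply/funext => n; rewrite seriesEnat /= big1.
apply: (cvg_norms_dominated (norms_lincomb a x y)).
exact/is_cvg_seriesD/cy/is_cvg_seriesZ.
Qed.

Fact in_c0_submod : submod_closed in_c0.
Proof.
split=> [|a x y /asboolP cx /asboolP cy]; apply/asboolP.
  by rewrite norms_zero; exact: cvg_cst.
apply: (norms0_dominated (norms_lincomb a x y)).
by rewrite -[0 in X in _ --> X](addr0 0) -[X in X + _](mulr0 (realpart `|a|));
  apply: cvgD => //; apply: cvgMr.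
Qed.

HB.instance Definition _ := GRing.isSubmodClosed.Build K vseq in_l1 in_l1_submod.
HB.instance Definition _ := GRing.isSubmodClosed.Build K vseq in_c0 in_c0_submod.

Record l1_sum := L1Sum { l1_seq :> vseq; l1P : l1_seq \in in_l1 }.
HB.instance Definition _ := [isSub for l1_seq].
HB.instance Definition _ := [Choice of l1_sum by <:].
HB.instance Definition _ := [SubChoice_isSubLmodule of l1_sum by <:].

Record c0_sum := C0Sum { c0_seq :> vseq; c0P : c0_seq \in in_c0 }.
HB.instance Definition _ := [isSub for c0_seq].
HB.instance Definition _ := [Choice of c0_sum by <:].
HB.instance Definition _ := [SubChoice_isSubLmodule of c0_sum by <:].

Definition l1_norm (x : l1_sum) : K :=
  of_real F (limn (series (norms x))).

(* The supremum is a maximum, see [c0_norm_max]. *)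
Definition c0_norm (x : c0_sum) : K :=
  of_real F (sup [set rnorm (x n) | n in [set: nat]]).

Lemma c0_max (x : c0_sum) :
  exists n, forall k, norms x k <= norms x n.
Proof.
have /asboolP x0 := c0P x.
have [xn0|/existsNP[n0 xn0]] := pselect (forall n, norms x n = 0).
  by exists 0%N => k; rewrite !xn0.
have pos : 0 < norms x n0.
  by rewrite lt_neqAle rnorm_ge0 andbT eq_sym; apply/eqP.
have [N _ HN] : \forall k \near \oo, norms x k <= norms x n0.
  exact: (cvgr_le 0).
have [m _ Hm] : exists2 m : 'I_(maxn N n0).+1, true &
    forall k : 'I_(maxn N n0).+1, norms x k <= norms x m.
  by case: (@arg_maxP _ _ _ ord0 xpredT (fun i : 'I_(maxn N n0).+1 => norms x i))
    => // m _ Hm; exists m => // k; exact: Hm.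
have n0m : norms x n0 <= norms x m.
  have h : (n0 < (maxn N n0).+1)%N by rewrite ltnS leq_maxr.
  exact: (Hm (Ordinal h)).
exists m => k; have [kN|Nk] := ltnP k (maxn N n0).+1.
  exact: (Hm (Ordinal kN)).
apply: le_trans n0m; apply: HN => /=.
by rewrite (leq_trans (leq_maxl N n0))// ltnW.
Qed.

Lemma c0_norm_max (x : c0_sum) : exists2 n, c0_norm x = `|x n| &
  forall k, `|x k| <= c0_norm x.
Proof.
have [n Hn] := c0_max x.
have E : c0_norm x = `|x n|.
  rewrite -rnormE /c0_norm; congr of_real; apply/eqP; rewrite eq_le.
  apply/andP; split.
    by apply: ge_sup; [exists (norms x n), n|move=> _ [k _ <-]; exact: Hn].
  apply: ub_le_sup; last by exists n.
  by exists (norms x n) => _ [k _ <-]; exact: Hn.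
by exists n => // k; rewrite E -!rnormE ler_of_real; exact: Hn.
Qed.

Fact l1_normD (x y : l1_sum) : l1_norm (x + y) <= l1_norm x + l1_norm y.
Proof.
have /asboolP cx := l1P x; have /asboolP cy := l1P y.
have /asboolP cxy := l1P (x + y).
rewrite /l1_norm -of_realD ler_of_real.
rewrite -lim_seriesD//; apply: lim_series_le => //.
  exact: is_cvg_seriesD.
by move=> n; exact: ler_rnormD.
Qed.

Fact l1_normZ (a : K) (x : l1_sum) : l1_norm (a *: x) = `|a| * l1_norm x.
Proof.
have /asboolP cx := l1P x.
rewrite /l1_norm -[`|a|]ge0_realpartK// -of_realM; congr of_real.
have -> : norms (a *: x) = realpart `|a| *: norms x.
  by apply/funext => n; exact: rnormZ.
exact: lim_seriesZ.
Qed.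

Fact l1_norm0_eq0 (x : l1_sum) : l1_norm x = 0 -> x = 0.
Proof.
have /asboolP cx := l1P x.
move=> /(congr1 (@realpart R F)); rewrite of_realK.
rewrite (_ : realpart 0 = 0); last by case: (F).
move=> x0; apply/val_inj/functional_extensionality_dep => n /=.
apply: rnorm0_eq0; apply/eqP; rewrite eq_le rnorm_ge0 andbT -x0.
apply: le_trans (nondecreasing_cvgn_le _ cx n.+1).
  by rewrite seriesEnat /= big_nat_recr//= lerDr sumr_ge0// => i _; exact: rnorm_ge0.
by apply: nondecreasing_series => i _ _; exact: rnorm_ge0.
Qed.

HB.instance Definition _ :=
  Lmodule_isNormed.Build K l1_sum l1_normD l1_normZ l1_norm0_eq0.

Fact c0_normD (x y : c0_sum) : c0_norm (x + y) <= c0_norm x + c0_norm y.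
Proof.
have [n -> _] := c0_norm_max (x + y).
have [_ _ Hx] := c0_norm_max x; have [_ _ Hy] := c0_norm_max y.
exact: le_trans (ler_normD _ _) (lerD (Hx n) (Hy n)).
Qed.

Fact c0_normZ (a : K) (x : c0_sum) : c0_norm (a *: x) = `|a| * c0_norm x.
Proof.
have [m E Hax] := c0_norm_max (a *: x); have [n E' Hx] := c0_norm_max x.
apply/eqP; rewrite eq_le; apply/andP; split.
  by rewrite E [leLHS](normrZ a (x m)); apply: ler_wpM2l => //; exact: Hx.
by rewrite E' -normrZ; exact: Hax.
Qed.

Fact c0_norm0_eq0 (x : c0_sum) : c0_norm x = 0 -> x = 0.
Proof.
have [_ _ Hx] := c0_norm_max x => x0.
apply/val_inj/functional_extensionality_dep => n /=.
by apply/eqP; rewrite -normr_le0 -x0; exact: Hx.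
Qed.

HB.instance Definition _ :=
  Lmodule_isNormed.Build K c0_sum c0_normD c0_normZ c0_norm0_eq0.

End vector_sequences.

(* Main.v *)
(** Norming functionals of [x] are controlled coordinatewise.

    In the [l1]-sum, [norm y = norm (y n) + norm (y - y n e_n)]; hence a norming
    functional of [x] restricts to norming functionals of the [x n], and its
    [n]-th component can be replaced by any other norming functional of [x n]
    without disturbing the rest.  When [x n = 0] the replacements [f] and [- f],
    with [f] of norm 1, are at distance 2.  Splicing a component into one
    Hahn-Banach functional on the whole sum avoids summing infinitely many
    components, so that no completeness of the scalars is needed.

    In the [c0]-sum, a norming functional of [x] kills every [y] that vanishes
    at a strict peak of [x], since small perturbations of [x] along
    [y] keep its norm; two peaks give two norming functionals at distance 2,
    as seen on [x m e_m - x k e_k].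

    The Hahn-Banach theorem is obtained by applying Zorn's lemma to sublinear
    functionals instead of partial linear ones: if [q] is minimal, then the
    sublinear [x |-> inf_(t >= 0) (q (x + t a) - t q a)], which is at most [q],
    equals it, so [q x <= q (x + a) - q a] and [q] is additive, hence linear. *)
Require Import Defs.
From HB Require Import structures.
From mathcomp Require Import all_boot all_order all_algebra.
From mathcomp Require Import all_classical all_reals all_analysis.
From mathcomp.real_closed Require Import complex.
From mathcomp Require Import lra.

Import Order.TTheory GRing.Theory Num.Theory.
Import numFieldNormedType.Exports.

Set Implicit Arguments.
Unset Strict Implicit.
Unset Printing Implicit Defensive.

Local Open Scope classical_set_scope.
Local Open Scope ring_scope.

(** * Lower bounds on sums and multiples of infima *)

Section inf_bounds.
Context {R : realType}.
Implicit Types (E : set R) (c t : R).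

Lemma le_infD E1 E2 c : E1 !=set0 -> E2 !=set0 ->
  (forall a b, E1 a -> E2 b -> c <= a + b) -> c <= inf E1 + inf E2.
Proof.
move=> E10 E20 H; rewrite -lerBlDr; apply: lb_le_inf => // a E1a.
rewrite lerBlDr -lerBlDl; apply: lb_le_inf => // b E2b.
by rewrite lerBlDl; exact: H.
Qed.

Lemma le_infZ E c t : 0 <= t -> E !=set0 ->
  (forall a, E a -> c <= t * a) -> c <= t * inf E.
Proof.
rewrite le_eqVlt => /predU1P[<-|t0] E0 H.
  by have [a Ea] := E0; have := H a Ea; rewrite !mul0r.
rewrite -ler_pdivrMl//; apply: lb_le_inf => // a Ea.
by rewrite ler_pdivrMl//; exact: H.
Qed.

End inf_bounds.

(** * The real Hahn-Banach theorem through minimal sublinear functionals *)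

Section hahn_banach.
Context {R : realType} {V : lmodType R}.
Implicit Types (p q : V -> R) (x y a : V).

(** Homogeneity is asked only as an inequality, the form that passes to infima; [sublinearZ]
    recovers equality by rescaling with the inverse. *)
Definition sublinear p := (forall x y, p (x + y) <= p x + p y) /\
  (forall t x, 0 <= t -> p (t *: x) <= t * p x).

Section sublinear_theory.
Variable p : V -> R.
Hypothesis p_sub : sublinear p.

Lemma sublinearD x y : p (x + y) <= p x + p y.
Proof. exact: p_sub.1. Qed.

Lemma sublinear0 : p 0 = 0.
Proof.
apply/le_anti/andP; split.
  by have := p_sub.2 0 0 (lexx 0); rewrite scale0r mul0r.
by have := sublinearD 0 0; rewrite addr0 lerDl.
Qed.

Lemma sublinearZ t x : 0 <= t -> p (t *: x) = t * p x.
Proof.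
rewrite le_eqVlt => /predU1P[<-|t0]; first by rewrite scale0r mul0r sublinear0.
apply/le_anti; rewrite (p_sub.2 _ _ (ltW t0))/=.
rewrite -ler_pdivlMl// -{1}[x](scalerK (lt0r_neq0 t0)).
by apply: p_sub.2; rewrite invr_ge0 ltW.
Qed.

Lemma sublinear_geN x : - p (- x) <= p x.
Proof.
by rewrite lerNl -subr_ge0 opprK -sublinear0 -(addNr x); exact: sublinearD.
Qed.

Lemma sublinear_shift a : exists q,
  [/\ sublinear q, forall x, q x <= p x & forall x, q x <= p (x + a) - p a].
Proof.
pose E x := [set p (x + t *: a) - t * p a | t in [set t : R | 0 <= t]].
have E0 x : E x !=set0 by exists (p (x + 0 *: a) - 0 * p a), 0 => /=.
have lbE x : has_lbound (E x).
  (* This bound is subadditivity for [t *: a = - x + (x + t *: a)]. *)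
  exists (- p (- x)) => _ [t /= t0 <-]; rewrite lerBrDr -sublinearZ// addrC lerBlDr.
  by rewrite -[X in p X <= _](addKr x) [X in _ <= X]addrC sublinearD.
have leE t x : 0 <= t -> inf (E x) <= p (x + t *: a) - t * p a.
  by move=> t0; apply: ge_inf => //; exists t.
exists (fun x => inf (E x)); split => [|x|x].
- split=> [x y|s x s0].
    apply: le_infD => // _ _ [t t0 <-] [s s0 <-].
    apply: le_trans (leE (t + s) _ _) _; first exact: addr_ge0.
    by rewrite addrACA -opprD -mulrDl lerB// scalerDl addrACA sublinearD.
  apply: le_infZ => // _ [t t0 <-].
  apply: le_trans (leE (s * t) _ _) _; first exact: mulr_ge0.
  by rewrite -scalerA -scalerDr sublinearZ// mulrBr mulrA.
(* The parameters [t = 0] and [t = 1] give the two upper bounds. *)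
- by apply: le_trans (leE 0 x _) _ => //; rewrite scale0r mul0r addr0 subr0.
- by apply: le_trans (leE 1 x _) _ => //; rewrite scale1r mul1r.
Qed.

End sublinear_theory.

(** Zorn's lemma for the reversed pointwise order. A non-empty chain is bounded by its pointwise
    infimum, finite since all members stay above [- p (- x)]; the empty chain is bounded by [p]. *)
Lemma minimal_sublinear p : sublinear p -> exists q,
  [/\ sublinear q, forall x, q x <= p x &
      forall r, sublinear r -> (forall x, r x <= q x) -> forall x, q x <= r x].
Proof.
move=> p_sub; pose T := {q : V -> R | sublinear q /\ forall x, q x <= p x}.
pose mk q (q_sub : sublinear q) (qp : forall x, q x <= p x) : T :=
  exist _ q (conj q_sub qp).
pose le_rev (s t : T) := `[< forall x, sval t x <= sval s x >].
have [| | |q q_min] := @ZL_preorder T (mk p p_sub (fun=> lexx _)) le_rev.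
- by move=> s; apply/asboolP.
- move=> s r t /asboolP rs /asboolP st; apply/asboolP => x.
  exact: le_trans (st x) (rs x).
- move=> A A_tot; have [[s0 As0]|A0] := pselect (A !=set0); last first.
    exists (mk p p_sub (fun=> lexx _)) => s As.
    by case: A0; exists s.
  pose E x := [set sval s x | s in A].
  have E0 x : E x !=set0 by exists (sval s0 x), s0.
  have lbE x : has_lbound (E x).
    exists (- p (- x)) => _ [s As <-].
    have [s_sub sp] := svalP s.
    apply: le_trans (sublinear_geN s_sub x).
    by rewrite lerN2 sp.
  have leE s x : A s -> inf (E x) <= sval s x.
    by move=> As; apply: ge_inf => //; exists s.
  have m_sub : sublinear (fun x => inf (E x)).
    split=> [x y|t x t0].
      apply: le_infD => // _ _ [s As <-] [t At <-].
      (* Subadditivity of the infimum uses the chain condition: the smaller of [s] and [t] serves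
         for both arguments. *)
      have [/asboolP st|/asboolP ts] := A_tot s t As At.
        apply: le_trans (leE _ _ At) (le_trans ((svalP t).1.1 _ _) _).
        by rewrite lerD2r.
      apply: le_trans (leE _ _ As) (le_trans ((svalP s).1.1 _ _) _).
      by rewrite lerD2l.
    apply: le_infZ => // _ [s As <-].
    exact: le_trans (leE _ _ As) ((svalP s).1.2 _ _ t0).
  have mp x : inf (E x) <= p x by exact: le_trans (leE _ _ As0) ((svalP s0).2 x).
  exists (mk _ m_sub mp) => s As; apply/asboolP => x /=.
  exact: leE.
- exists (sval q); have [q_sub qp] := svalP q; split=> // r r_sub rq x.
  have rp y : r y <= p y by exact: le_trans (rq y) (qp y).
  by have /asboolP := q_min (mk r r_sub rp) (asboolT rq); exact.
Qed.

Lemma hahn_banach p x0 : sublinear p ->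
  exists u : V -> R, [/\ scalar u, forall x, u x <= p x & u x0 = p x0].
Proof.
(* Shifting by [x0] before minimising fixes the value there: [p0 (- x0) <= p 0 - p x0 = - p x0],
   hence [u x0 >= p x0] for a linear [u] below [p0]. *)
move=> p_sub; have [p0 [p0_sub p0p p0x0]] := sublinear_shift p_sub x0.
have [u [u_sub up0 u_min]] := minimal_sublinear p0_sub.
have up x : u x <= p x := le_trans (up0 x) (p0p x).
have uD x y : u (x + y) = u x + u y.
  apply/le_anti; rewrite sublinearD//= -lerBrDr.
  have [r [r_sub ru rxy]] := sublinear_shift u_sub y.
  exact: le_trans (u_min r r_sub ru x) (rxy x).
have uN x : u (- x) = - u x.
  by apply/eqP; rewrite -addr_eq0 -uD addNr sublinear0.
exists u; split=> // [t x y|].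
  rewrite uD; congr (_ + _); have [t0|t0] := leP 0 t; first exact: sublinearZ.
  rewrite -[t *: x]opprK -scaleNr uN sublinearZ ?oppr_ge0 ?ltW//.
  by rewrite mulNr opprK.
apply/le_anti; rewrite up /= -lerN2 -uN.
apply: le_trans (up0 _) (le_trans (p0x0 _) _).
by rewrite addNr sublinear0// sub0r.
Qed.

End hahn_banach.

(** * Real parts and moduli of scalars *)

Section scalars_facts.
Context {R : realType} {F : scalar_kind}.
Local Notation K := (scalars R F).
Implicit Types (t : R) (z w : K).

Lemma of_real0 : of_real F 0 = 0 :> K.
Proof. by case: F. Qed.

Lemma of_real1 : of_real F 1 = 1 :> K.
Proof. by case: F. Qed.

Lemma realpartD z w : realpart (z + w) = realpart z + realpart w.
Proof. by move: z w; case: F => //= -[a b] [c d]. Qed.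

Lemma realpart1 : realpart (1 : K) = 1.
Proof. by case: F. Qed.

Lemma of_real_norm t : 0 <= t -> `|of_real F t| = of_real F t.
Proof. by move=> t0; rewrite ger0_norm// -of_real0 ler_of_real. Qed.

Lemma realpart_normM z w : realpart `|z * w| = realpart `|z| * realpart `|w|.
Proof. by apply: (can_inj (@of_realK R F)); rewrite of_realM !ge0_realpartK// normrM. Qed.

Lemma ler_realpart_norm z : realpart z <= realpart `|z|.
Proof.
move: z; case: F => /= z; first exact: ler_norm.
by apply: le_trans (ler_norm _) _; have := normc_ge_Re z; rewrite complex.lecE => /andP[].
Qed.

(** A real part that reaches the modulus leaves no room for an imaginary part. Identities such as
    [f u = |u|] can thus be proved on real parts. *)
Lemma realpart_eq_norm z : realpart `|z| <= realpart z -> z = `|z|.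
Proof.
move: z; case: F => /= [z|[a b]]; first by move=> z_ge; rewrite ger0_norm// (le_trans _ z_ge).
rewrite normc_def /= => le_a; have a0 : 0 <= a by apply: le_trans le_a; exact: sqrtr_ge0.
have := le_a; rewrite -{2}(ger0_norm a0) -sqrtr_sqr ler_sqrt ?sqr_ge0//.
rewrite -lerBrDl subrr => b_le0.
have /eqP b0 : b == 0 by rewrite -sqrf_eq0 eq_le b_le0 sqr_ge0.
by rewrite b0 expr0n/= addr0 sqrtr_sqr ger0_norm.
Qed.

Lemma unimodular_rotation z : exists2 c : K, `|c| = 1 & c * z = `|z|.
Proof.
have [->|z0] := eqVneq z 0; first by exists 1; rewrite ?normr1// normr0 mulr0.
exists (`|z| / z); last by rewrite divfK.
by rewrite normf_div normr_id divff// normr_eq0.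
Qed.

End scalars_facts.

(** * Restriction of scalars to [R], and functionals with prescribed real part *)

Section realification.
Context {R : realType} {F : scalar_kind}.
Local Notation K := (scalars R F).

(** A second name for [V], so that an [R]-module structure can live beside the [K]-module
    structure. *)
Definition realification (V : lmodType K) : Type := V.
Variable V : lmodType K.

HB.instance Definition _ := GRing.Zmodule.on (realification V).

Definition real_scale (t : R) (v : realification V) : realification V :=
  of_real F t *: (v : V).

Fact real_scaleA s t v : real_scale s (real_scale t v) = real_scale (s * t) v.
Proof. by rewrite /real_scale scalerA of_realM. Qed.
Fact real_scale1 : left_id 1 real_scale.
Proof. by move=> v; rewrite /real_scale of_real1 scale1r. Qed.
Fact real_scaleDr : right_distributive real_scale +%R.
Proof. by move=> t v w; exact: scalerDr. Qed.
Fact real_scaleDl v : {morph real_scale^~ v : s t / s + t}.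
Proof. by move=> s t; rewrite /real_scale of_realD; exact: scalerDl. Qed.

HB.instance Definition _ := GRing.Zmodule_isLmodule.Build R (realification V)
  real_scaleA real_scale1 real_scaleDr real_scaleDl.

End realification.

(** Over the complex scalars, [f v = u v - i u (i v)], whose linearity follows from that of [u] and
    [i * i = - 1]; over the reals, [f] is [u]. *)
Lemma realpart_extension (R : realType) (F : scalar_kind)
    (V : lmodType (scalars R F)) (u : realification V -> R) : scalar u ->
  exists2 f : V -> (scalars R F)^o, linear f & forall v, realpart (f v) = u v.
Proof.
case: F V u => V u u_lin; first by exists u.
pose i : scalars R ComplexScalars := complex.Complex 0 1.
exists (fun v => complex.Complex (u v) (- u (i *: v))) => // -[a b] v w.
have uD (x y : V) : u (x + y : V) = u x + u y.
  by have := u_lin 1 x y; rewrite scale1r mul1r.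
have uZ t (x : V) : u (complex.Complex t 0 *: x) = t * u x.
  have u0 : u 0 = 0 by apply: (addrI (u 0)); rewrite -uD !addr0.
  by have := u_lin t x 0; rewrite !addr0 u0 addr0.
have E (x : V) : u (complex.Complex a b *: x) = a * u x + b * u (i *: x).
  have -> : complex.Complex a b = complex.Complex a 0 + complex.Complex b 0 * i
      :> scalars R ComplexScalars.
    by apply/eqP; rewrite complex.eq_complex /=; apply/andP; split; apply/eqP; lra.
  by rewrite scalerDl -scalerA uD !uZ.
have ii : i * i = complex.Complex (- 1) 0.
  by apply/eqP; rewrite complex.eq_complex /=; apply/andP; split; apply/eqP; lra.
rewrite scalerDr !uD scalerA [i * _]mulrC -scalerA !E scalerA ii uZ.
by apply/eqP; rewrite complex.eq_complex /=; apply/andP; split; apply/eqP; lra.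
Qed.

Lemma linear_bundle (K : nzRingType) (V W : lmodType K) (f : V -> W) :
  linear f -> exists g : {linear V -> W}, f = g.
Proof.
move=> f_lin; pose L := GRing.isLinear.Build K V W *:%R f f_lin.
pose g : {linear V -> W} := HB.pack f L.
by exists g.
Qed.

(** * Existence of norming functionals *)

Section norming.
Context {R : realType} {F : scalar_kind} {X : normedModType (scalars R F)}.
Local Notation K := (scalars R F).
Implicit Types (x y : X) (f g : X -> K^o).

(** For non-zero [x] this is [J x], freed from suprema ([J_norming]). At [x = 0] it is the whole
    dual unit ball, which is what a vanishing coordinate calls for. *)
Definition norming x : set (X -> K^o) :=
  [set f | [/\ linear f, forall y, rnorm (f y) <= rnorm y & f x = `|x|]].

Lemma norming_exists x : norming x !=set0.
Proof.
have rnorm_sub : sublinear (rnorm : realification X -> R).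
  split=> [y z|t y t0]; first exact: (@ler_rnormD _ _ X).
  rewrite -[t in leRHS](of_realK F) -[in leRHS](of_real_norm t0).
  by rewrite -(@rnormZ _ _ X).
have [u [u_lin u_le ux]] := hahn_banach (x : realification X) rnorm_sub.
have [f f_lin fu] := realpart_extension u_lin.
(* A unit scalar turns [f y] into its modulus, so the bound on real parts becomes a bound on
   moduli. *)
have f_le y : rnorm (f y) <= rnorm y.
  have [c c1 cfy] := unimodular_rotation (f y).
  have -> : rnorm (f y) = u (c *: y).
    have [g fg] := linear_bundle f_lin.
    by rewrite -fu /rnorm -cfy; congr realpart; rewrite fg linearZ.
  by rewrite (le_trans (u_le _))// (@rnormZ _ _ X) c1 realpart1 mul1r.
exists f; split=> //.
have fx : realpart (f x) = rnorm x by rewrite fu.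
have fE : f x = `|f x| by apply: realpart_eq_norm; rewrite fx; exact: f_le.
by rewrite -(rnormE x) -fx fE ge0_realpartK.
Qed.

End norming.

Section rnorm_facts.
Context {R : realType} {F : scalar_kind} {X : normedModType (scalars R F)}.
Implicit Types x y : X.

Lemma rnorm_norm x : rnorm (`|x| : (scalars R F)^o) = rnorm x.
Proof. by rewrite /rnorm normr_id. Qed.

Lemma rnorm_of_real (t : R) : 0 <= t -> rnorm (of_real F t : (scalars R F)^o) = t.
Proof. by move=> t0; rewrite /rnorm of_real_norm// of_realK. Qed.

Lemma rnormN x : rnorm (- x) = rnorm x.
Proof. by rewrite /rnorm normrN. Qed.

Lemma ler_rnormB x y : rnorm (x - y) <= rnorm x + rnorm y.
Proof. by rewrite -(rnormN y) ler_rnormD. Qed.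

Lemma rnorm_gt0 x : x != 0 -> 0 < rnorm x.
Proof.
move=> x0; rewrite lt0r rnorm_ge0 andbT.
by apply: contra_neq x0; exact: rnorm0_eq0.
Qed.

End rnorm_facts.

(** * The dual norm, and [D] in terms of norming functionals *)

Section dual_norm_theory.
Context {R : realType} {F : scalar_kind} {X : normedModType (scalars R F)}.
Local Notation K := (scalars R F).
Implicit Types (x y : X) (f g : X -> K^o) (M : R).

Lemma dual_norm_le f M : 0 <= M ->
  (forall y, rnorm (f y) <= M * rnorm y) -> dual_norm f <= M.
Proof.
move=> M0 f_le; apply: ge_sup; first by exists (rnorm (f 0)), 0 => //=; rewrite rnorm0.
by move=> _ [y /= y1 <-]; apply: le_trans (f_le y) _; rewrite ler_piMr.
Qed.

Section bounded_linear.
Variables (f : X -> K^o) (M : R).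
Hypothesis f_lin : linear f.
Hypothesis f_le : forall y, rnorm (f y) <= M * rnorm y.

(** [f] is tested at [y] rescaled to norm 1. The bound [f_le] ensures that [dual_norm f] is a
    genuine supremum and not a default value. *)
Lemma le_dual_norm y : rnorm (f y) <= dual_norm f * rnorm y.
Proof.
have [g fg] := linear_bundle f_lin.
have [->|y0] := eqVneq y 0; first by rewrite fg linear0 !rnorm0 mulr0.
have ny := rnorm_gt0 y0.
have n_inv : realpart `|of_real F (rnorm y)^-1| = (rnorm y)^-1.
  by rewrite of_real_norm ?of_realK// invr_ge0 ltW.
have fZ : rnorm (f (of_real F (rnorm y)^-1 *: y)) = (rnorm y)^-1 * rnorm (f y).
  by rewrite fg linearZ rnormZ n_inv.
rewrite -ler_pdivrMr// mulrC -fZ; apply: ub_le_sup.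
  exists `|M| => _ [z /= z1 <-]; apply: le_trans (f_le z) _.
  apply: le_trans (ler_wpM2r (rnorm_ge0 z) (ler_norm M)) _.
  by rewrite ler_piMr.
by exists (of_real F (rnorm y)^-1 *: y) => //=; rewrite rnormZ n_inv mulVf ?gt_eqF.
Qed.

Lemma bounded_linear_dual_space : dual_space f.
Proof.
split=> //; have [g fg] := linear_bundle f_lin; rewrite fg.
apply/bounded_linear_continuous/linear_boundedP.
have M_real : of_real F M \is Num.real.
  by rewrite realE -of_real0 !ler_of_real le_total.
apply: filterS (nbhs_pinfty_ge M_real) => r rM y.
rewrite -fg -!rnormE.
apply: le_trans (_ : of_real F M * of_real F (rnorm y) <= _).
  by rewrite -of_realM ler_of_real.
by rewrite ler_wpM2r// rnormE.
Qed.

End bounded_linear.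

Lemma dual_space_bounded f : dual_space f ->
  exists M, forall y, rnorm (f y) <= M * rnorm y.
Proof.
move=> [f_lin f_cont]; have [g fg] := linear_bundle f_lin.
move: f_cont; rewrite fg => /linear_bounded_continuous/linear_boundedP.
move=> /pinfty_ex_gt0[r r0 g_le]; exists (realpart r) => y.
rewrite -(ler_of_real F) of_realM !rnormE (ge0_realpartK (ltW r0)).
exact: g_le.
Qed.

(** Continuity gives boundedness, so dual norm 1 yields the pointwise bound; conversely the value at
    the non-zero [x] forces the dual norm up to 1. *)
Lemma J_norming x : x != 0 -> J x = norming x.
Proof.
move=> x0; apply/seteqP; split => f [].
  move=> f_dual f1 fx; have [f_lin _] := f_dual.
  have [M f_le] := dual_space_bounded f_dual.
  split=> // y; rewrite -[leRHS]mul1r -f1; exact: le_dual_norm f_lin f_le y.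
move=> f_lin f_le fx.
have f_le1 y : rnorm (f y) <= 1 * rnorm y by rewrite mul1r.
split=> //; first exact: bounded_linear_dual_space f_lin f_le1.
apply/le_anti; rewrite dual_norm_le//= -(ler_pM2r (rnorm_gt0 x0)) mul1r.
rewrite -[leLHS]rnorm_norm -fx; exact: le_dual_norm f_lin f_le1 x.
Qed.

Lemma norming_sub_le x f g y : norming x f -> norming x g ->
  rnorm (f y - g y) <= 2 * rnorm y.
Proof.
move=> [_ f_le _] [_ g_le _]; apply: le_trans (ler_rnormB _ _) _.
by rewrite mulr_natl mulr2n lerD.
Qed.

Lemma norming_sub_linear x f g : norming x f -> norming x g -> linear (f - g).
Proof.
move=> [f_lin _ _] [g_lin _ _] a u v.
have E z : (f - g) z = f z - g z by [].
by rewrite !E f_lin g_lin opprD addrACA -scalerBr.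
Qed.

(** With [D_le], this makes [D x] the least constant bounding differences of norming functionals.
    The supremum is finite because such differences have dual norm at most 2. *)
Lemma D_ge x f g y : x != 0 -> norming x f -> norming x g ->
  rnorm (f y - g y) <= D x * rnorm y.
Proof.
move=> x0 xf xg; have fg_lin := norming_sub_linear xf xg.
have fg_le z := norming_sub_le z xf xg.
apply: le_trans (le_dual_norm fg_lin fg_le y) _.
apply: ler_wpM2r; first exact: rnorm_ge0.
apply: ub_le_sup; last by rewrite J_norming//; exists f => //; exists g.
exists 2 => _ [h Jh [k Jk <-]]; move: Jh Jk; rewrite J_norming// => xh xk.
by apply: dual_norm_le => // z; exact: (norming_sub_le z xh xk).
Qed.

Lemma D_le x M : x != 0 -> 0 <= M ->
  (forall f g, norming x f -> norming x g ->
    forall y, rnorm (f y - g y) <= M * rnorm y) -> D x <= M.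
Proof.
move=> x0 M0 fg_le; apply: ge_sup.
  have [f xf] := norming_exists x.
  by exists (dual_norm (f - f)); rewrite J_norming//; exists f => //; exists f.
move=> _ [f Jf [g Jg <-]]; move: Jf Jg; rewrite J_norming// => xf xg.
by apply: dual_norm_le => // y; exact: fg_le.
Qed.

Lemma D_le2 x : x != 0 -> D x <= 2.
Proof. by move=> x0; apply: D_le => // f g xf xg y; exact: norming_sub_le xf xg. Qed.

Lemma D_ge0 x : x != 0 -> 0 <= D x.
Proof.
move=> x0; have [f xf] := norming_exists x.
rewrite -(pmulr_lge0 _ (rnorm_gt0 x0)).
by apply: le_trans (D_ge x x0 xf xf); exact: rnorm_ge0.
Qed.

Lemma D_eq2 x f g y : x != 0 -> norming x f -> norming x g -> y != 0 ->
  2 * rnorm y <= rnorm (f y - g y) -> D x = 2.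
Proof.
move=> x0 xf xg y0 fgy; apply/le_anti; rewrite D_le2//=.
by rewrite -(ler_pM2r (rnorm_gt0 y0)); apply: le_trans fgy (D_ge y x0 xf xg).
Qed.

End dual_norm_theory.

(** * Norming functionals at zero and on summands *)

Section norming_functionals.
Context {R : realType} {F : scalar_kind} {X : normedModType (scalars R F)}.
Local Notation K := (scalars R F).
Implicit Types (x u v : X) (f : X -> K^o).

(** The dual unit ball is symmetric; this supplies the antipodal pair at a vanishing coordinate. *)
Lemma norming_zero_opp x f : norming x f -> norming 0 f /\ norming 0 (- f).
Proof.
move=> [f_lin f_le _]; have [g fg] := linear_bundle f_lin.
have E z : (- f : X -> K^o) z = - f z by [].
split; split=> //; first by rewrite fg linear0 normr0.
- by move=> a u v; rewrite !E f_lin opprD scalerN.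
- by move=> y; rewrite E rnormN.
- by rewrite E fg linear0 normr0 oppr0.
Qed.

(** The real parts of [f u] and [f v] add up to [rnorm u + rnorm v] while neither exceeds its own
    norm, so both bounds are attained. *)
Lemma norming_summand x u v f : norming x f -> x = u + v ->
  rnorm x = rnorm u + rnorm v -> f u = `|u|.
Proof.
move=> [f_lin f_le fx] xE nx; have [g fg] := linear_bundle f_lin.
have fxE : realpart (f u) + realpart (f v) = rnorm u + rnorm v.
  have fuv : f u + f v = f x by rewrite xE fg linearD.
  by rewrite -nx -realpartD fuv fx.
have fv : realpart (f v) <= rnorm v := le_trans (ler_realpart_norm _) (f_le v).
have fu : rnorm u <= realpart (f u) by lra.
have fuE : f u = `|f u|.
  by apply: realpart_eq_norm; exact: le_trans (f_le u) fu.
rewrite fuE -!rnormE; congr of_real; apply/le_anti; rewrite f_le /=.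
exact: le_trans fu (ler_realpart_norm _).
Qed.

End norming_functionals.

(** * L-projections: a component whose norm splits off additively *)

Section l_projection.
Context {R : realType} {F : scalar_kind} {E X : normedModType (scalars R F)}.
Local Notation K := (scalars R F).
Variables (i : {linear X -> E}) (p : {linear E -> X}).
Implicit Types (x : E) (v : X).
Hypothesis iK : cancel i p.
Hypothesis rnorm_split : forall y, rnorm y = rnorm (p y) + rnorm (y - i (p y)).

Lemma rnorm_l_injection v : rnorm (i v) = rnorm v.
Proof. by rewrite rnorm_split iK subrr rnorm0 addr0. Qed.

Lemma norming_l_injection x (f : E -> K^o) :
  norming x f -> norming (p x) (fun v => f (i v)).
Proof.
move=> xf; have [f_lin f_le _] := xf; split=> [a u v|v|].
- by rewrite linearP f_lin.
- by rewrite -(rnorm_l_injection v) f_le.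
- rewrite (norming_summand (u := i (p x)) (v := x - i (p x)) xf).
  + by rewrite -!rnormE rnorm_l_injection.
  + by rewrite addrC subrK.
  + by rewrite rnorm_l_injection -rnorm_split.
Qed.

(** The norm bound adds up along [rnorm_split]; the value at [x] is right because [h] already norms
    [i (p x)], so [f] contributes what was removed. *)
Lemma norming_splice x (h : E -> K^o) (f : X -> K^o) :
  norming x h -> norming (p x) f ->
  norming x (fun y => h (y - i (p y)) + f (p y)).
Proof.
move=> xh [f_lin f_le fx]; have [h_lin h_le hx] := xh.
have [_ _ hpx] := norming_l_injection xh.
have [h' hE] := linear_bundle h_lin.
split=> [a u v|y|].
- have pE : p (a *: u + v) = a *: p u + p v by exact: linearP.
  have ipE : i (p (a *: u + v)) = a *: i (p u) + i (p v) by rewrite pE; exact: linearP.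
  rewrite ipE pE opprD addrACA -scalerBr f_lin h_lin.
  by rewrite scalerDr addrACA.
- rewrite (rnorm_split y) addrC; apply: le_trans (ler_rnormD _ _) _.
  by rewrite lerD.
- have -> : h (x - i (p x)) = h x - h (i (p x)) by rewrite hE linearB.
  by rewrite fx hx hpx subrK.
Qed.

(** Two splices into the same [h] differ only through the component, as seen on [i v]. The case
    [p x = 0] is included on purpose, for [D_l_projection0]. *)
Lemma D_l_projection_ge x (f g : X -> K^o) v : x != 0 ->
  norming (p x) f -> norming (p x) g ->
  rnorm (f v - g v) <= D x * rnorm v.
Proof.
move=> x0 xf xg; have [h xh] := norming_exists x.
have := D_ge (i v) x0 (norming_splice xh xf) (norming_splice xh xg).
by rewrite /= rnorm_l_injection iK opprD addrACA subrr add0r.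
Qed.

Lemma D_l_projection x : p x != 0 -> D (p x) <= D x.
Proof.
move=> px0; have x0 : x != 0 by apply: contra_neq px0 => ->; rewrite linear0.
apply: D_le => // [|f g xf xg v]; first exact: D_ge0.
exact: D_l_projection_ge.
Qed.

Lemma D_l_projection0 x v : x != 0 -> p x = 0 -> v != 0 -> D x = 2.
Proof.
move=> x0 px v0; have [f vf] := norming_exists v.
have [f0 Nf0] := norming_zero_opp vf.
have fvE : rnorm (f v - (- f) v) = 2 * rnorm v.
  have -> : f v - (- f) v = of_real F 2 *: f v.
    rewrite -[2]/(1 + 1) of_realD of_real1 scalerDl scale1r.
    by congr (_ + _); exact: opprK.
  by rewrite rnormZ of_real_norm// of_realK; case: vf => _ _ ->; rewrite rnorm_norm.
apply/le_anti; rewrite D_le2//= -(ler_pM2r (rnorm_gt0 v0)) -fvE.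
by apply: D_l_projection_ge; rewrite ?px.
Qed.

End l_projection.

(** * Sequences supported on one coordinate *)

Section coordinate_injections.
Context {R : realType} {F : scalar_kind}.
Local Notation K := (scalars R F).
Variable X : nat -> normedModType K.
Implicit Types (n k : nat).

Definition vdelta n (v : X n) : vseq X := dfwith (fun k => 0 : X k) n v.

Lemma vdelta_in n (v : X n) : vdelta v n = v.
Proof. exact: dfwithin. Qed.

Lemma vdelta_out n (v : X n) k : n != k -> vdelta v k = 0.
Proof. exact: dfwithout. Qed.

Lemma vdelta_linear n : linear (@vdelta n).
Proof.
move=> a u v; apply: functional_extensionality_dep => k.
have E (x y : vseq X) : (a *: x + y) k = a *: x k + y k by [].
rewrite E; have [<-|nk] := eqVneq n k; first by rewrite !vdelta_in.
by rewrite !vdelta_out// scaler0 addr0.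
Qed.

Lemma norms_vdelta n (v : X n) k : norms (vdelta v) k = if k == n then rnorm v else 0.
Proof.
rewrite /norms; have [->|kn] := eqVneq k n; first by rewrite vdelta_in.
by rewrite vdelta_out ?rnorm0// eq_sym.
Qed.

Lemma series_norms_vdelta_near n (v : X n) :
  \forall m \near \oo, series (norms (vdelta v)) m = rnorm v.
Proof.
exists n.+1 => // m /= nm; rewrite seriesEnat /=.
under eq_bigr do rewrite norms_vdelta.
by rewrite -big_mkcond big_nat1_eq /= nm.
Qed.

Fact vdelta_l1 n (v : X n) : vdelta v \in @in_l1 R F X.
Proof.
apply/asboolP; apply: (cvgP (rnorm v)); apply: cvg_near_cst.
exact: series_norms_vdelta_near.
Qed.

Fact vdelta_c0 n (v : X n) : vdelta v \in @in_c0 R F X.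
Proof.
apply/asboolP; apply: cvg_near_cst; exists n.+1 => // m /= nm.
by rewrite norms_vdelta gtn_eqF.
Qed.

End coordinate_injections.

(** * The diameter in the [l1]-sum *)

Section l1_coordinates.
Context {R : realType} {F : scalar_kind}.
Local Notation K := (scalars R F).
Variable X : nat -> normedModType K.
Implicit Types (n k : nat) (x y : l1_sum X).

Definition l1_delta n (v : X n) : l1_sum X := L1Sum (vdelta_l1 v).
Definition l1_coord n y : X n := y n.

Fact l1_delta_linear n : linear (@l1_delta n).
Proof. by move=> a u v; apply: val_inj; exact: vdelta_linear. Qed.
Fact l1_coord_linear n : linear (l1_coord n).
Proof. by []. Qed.

HB.instance Definition _ n := GRing.isLinear.Build K (X n) (l1_sum X) *:%R
  (@l1_delta n) (@l1_delta_linear n).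
HB.instance Definition _ n := GRing.isLinear.Build K (l1_sum X) (X n) *:%R
  (l1_coord n) (@l1_coord_linear n).

Lemma l1_deltaK n : cancel (@l1_delta n) (l1_coord n).
Proof. exact: vdelta_in. Qed.

Lemma rnorm_l1E y : rnorm y = limn (series (norms y)).
Proof. exact: of_realK. Qed.

Lemma rnorm_l1_delta n (v : X n) : rnorm (l1_delta v) = rnorm v.
Proof.
rewrite rnorm_l1E; apply: cvg_lim => //; apply: cvg_near_cst.
exact: series_norms_vdelta_near.
Qed.

Lemma l1_sub_delta y n k : n != k -> (y - l1_delta (y n)) k = y k.
Proof.
have E (z w : l1_sum X) : (z - w) k = z k - w k by [].
by move=> nk; rewrite E [l1_delta _ k]vdelta_out// subr0.
Qed.

Lemma l1_sub_delta_same y n : (y - l1_delta (y n)) n = 0.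
Proof.
have E (z w : l1_sum X) : (z - w) n = z n - w n by [].
by rewrite E [l1_delta _ n]vdelta_in subrr.
Qed.

Lemma rnorm_l1_split n y :
  rnorm y = rnorm (l1_coord n y) + rnorm (y - l1_delta (l1_coord n y)).
Proof.
set z := y - _; rewrite -(rnorm_l1_delta (l1_coord n y)) !rnorm_l1E.
have /asboolP c1 := l1P (l1_delta (l1_coord n y)); have /asboolP c2 := l1P z.
rewrite -lim_seriesD//; congr (limn (series _)); apply/funext => k.
rewrite -[RHS]/(norms (l1_delta (l1_coord n y)) k + norms z k) norms_vdelta /norms.
have [->|kn] := eqVneq k n.
  by have -> : z n = 0 := l1_sub_delta_same y n; rewrite rnorm0 addr0.
have -> : z k = y k by apply: l1_sub_delta; rewrite eq_sym.
by rewrite add0r.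
Qed.

(** Coordinates below [n] are removed one at a time, so that [rnorm_l1_split] applies at each
    stage. *)
Fixpoint l1_tail y n : l1_sum X :=
  if n is k.+1 then l1_tail y k - l1_delta (l1_tail y k k) else y.

Lemma l1_tail_ge y n k : (n <= k)%N -> l1_tail y n k = y k.
Proof.
elim: n => // n IH nk.
by apply: etrans (IH (ltnW nk)); apply: l1_sub_delta; rewrite ltn_eqF.
Qed.

Lemma rnorm_l1_tail y n : rnorm (l1_tail y n) = rnorm y - series (norms y) n.
Proof.
elim: n => [|n IH]; first by rewrite seriesEnat /= big_geq// subr0.
rewrite seriesSr opprD addrA -IH [in RHS](rnorm_l1_split n (l1_tail y n)).
rewrite /l1_coord l1_tail_ge// /norms addrC addKr /=.
by rewrite l1_tail_ge.
Qed.

(** The first [n] coordinates cost at most [M] times their norms, and the tail at most [C] times its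
    norm, which tends to 0; so the crude constant [C] disappears in the limit. *)
Lemma l1_functional_le (h : {linear l1_sum X -> K^o}) (M C : R) y :
  (forall y, rnorm (h y) <= C * rnorm y) ->
  (forall n (v : X n), rnorm (h (l1_delta v)) <= M * rnorm v) ->
  rnorm (h y) <= M * rnorm y.
Proof.
move=> h_le h_delta.
have le_tail n : rnorm (h y) <= M * series (norms y) n + rnorm (h (l1_tail y n)).
  elim: n => [|n IH]; first by rewrite seriesEnat /= big_geq// mulr0 add0r.
  apply: le_trans IH _; rewrite seriesSr mulrDr -addrA lerD2l /=.
  have {1}-> : l1_tail y n = l1_delta (l1_tail y n n) +
      (l1_tail y n - l1_delta (l1_tail y n n)) by rewrite addrC subrK.
  rewrite [h (_ + _)]linearD; apply: le_trans (ler_rnormD _ _) _.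
  by rewrite lerD2r (le_trans (h_delta _ _))// l1_tail_ge.
have cy : series (norms y) @ \oo --> rnorm y.
  by rewrite rnorm_l1E; have /asboolP := l1P y.
have cM : (fun n => M * series (norms y) n + C * (rnorm y - series (norms y) n))
    @ \oo --> M * rnorm y + C * (rnorm y - rnorm y).
  by apply: cvgD; apply: cvgMr => //; apply: cvgB => //; exact: cvg_cst.
rewrite subrr mulr0 addr0 in cM.
apply: (ler_cvg_to (cvg_cst _) cM); apply: nearW => n /=.
by apply: le_trans (le_tail n) _; rewrite lerD2l -rnorm_l1_tail.
Qed.

Lemma D_l1_nonzero x : (forall n, x n != 0) ->
  D x = sup [set D (x n) | n in [set: nat]].
Proof.
move=> x0; have nz : x != 0.
  by apply: contra_neq (x0 0%N) => ->.
set S := [set _ | _ in _].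
have S0 : S !=set0 by exists (D (x 0%N)), 0%N.
have D_le_sup n : D (x n) <= sup S.
  by apply: ub_le_sup; [exists 2 => _ [k _ <-]; exact: D_le2|exists n].
apply/le_anti/andP; split; last first.
  apply: ge_sup => // _ [n _ <-].
  apply: (D_l_projection (@l1_deltaK n) (rnorm_l1_split n)); exact: x0.
apply: D_le => // [|f g xf xg y]; first exact: le_trans (D_ge0 (x0 0%N)) (D_le_sup 0%N).
have [h fgE] := linear_bundle (norming_sub_linear xf xg).
have E z : f z - g z = h z by rewrite -fgE.
(* The crude constant 2 is the triangle inequality; the sharp one comes from the restrictions to
   each coordinate, which norm [x n]. *)
rewrite E; apply: (l1_functional_le (C := 2)) => [z|n v].
  by rewrite -E; exact: norming_sub_le xf xg.
rewrite -E; apply: le_trans (ler_wpM2r (rnorm_ge0 v) (D_le_sup n)).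
apply: (D_ge (f := fun v => f (l1_delta v)) (g := fun v => g (l1_delta v))) => //.
  exact: (norming_l_injection (@l1_deltaK n) (rnorm_l1_split n) xf).
exact: (norming_l_injection (@l1_deltaK n) (rnorm_l1_split n) xg).
Qed.

Lemma D_l1_vanishing x n (v : X n) : x != 0 -> x n = 0 -> v != 0 -> D x = 2.
Proof. exact: (D_l_projection0 (@l1_deltaK n) (rnorm_l1_split n)). Qed.

End l1_coordinates.

(** * The diameter in the [c0]-sum *)

Section c0_coordinates.
Context {R : realType} {F : scalar_kind}.
Local Notation K := (scalars R F).
Variable X : nat -> normedModType K.
Implicit Types (n k : nat) (x y : c0_sum X).

Definition c0_delta n (v : X n) : c0_sum X := C0Sum (vdelta_c0 v).

Lemma c0_delta_linear n : linear (@c0_delta n).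
Proof. by move=> a u v; apply: val_inj; exact: vdelta_linear. Qed.

Lemma rnorm_c0_max y : exists2 n, rnorm y = rnorm (y n) &
  forall k, rnorm (y k) <= rnorm y.
Proof.
have [n yn y_le] := c0_norm_max y; exists n => [|k]; first exact: congr1 yn.
by rewrite -(ler_of_real F) !rnormE; exact: y_le.
Qed.

Lemma ler_rnorm_c0 y n : rnorm (y n) <= rnorm y.
Proof. by have [] := rnorm_c0_max y. Qed.

Lemma rnorm_c0_le y (M : R) : (forall n, rnorm (y n) <= M) -> rnorm y <= M.
Proof. by have [n -> _] := rnorm_c0_max y. Qed.

Lemma rnorm_c0_delta n (v : X n) : rnorm (c0_delta v) = rnorm v.
Proof.
apply/le_anti/andP; split; last first.
  by rewrite -[in leLHS](vdelta_in v); exact: (ler_rnorm_c0 (c0_delta v)).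
apply: rnorm_c0_le => k; have := norms_vdelta v k; rewrite /norms => ->.
by case: ifP => // _; exact: rnorm_ge0.
Qed.

Lemma norming_coord n x (f : X n -> K^o) :
  rnorm (x n) = rnorm x -> norming (x n) f -> norming x (fun y => f (y n)).
Proof.
move=> xn [f_lin f_le fx]; split=> [a u v|y|].
- by rewrite -f_lin.
- exact: le_trans (f_le _) (ler_rnorm_c0 _ _).
- by rewrite fx -!rnormE xn.
Qed.

(* The coordinates of [x] other than the [n]-th leave room for a small multiple
   of [y], so [x] perturbed by any such multiple keeps its norm. *)
Lemma norming_vanish_off_peak n x y (f : c0_sum X -> K^o) : x != 0 ->
  (forall k, rnorm (x k) = rnorm x <-> k = n) -> norming x f ->
  y n = 0 -> f y = 0.
Proof.
move=> x0 peak [f_lin f_le fx] yn; have [h fh] := linear_bundle f_lin.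
have [->|y0] := eqVneq y 0; first by rewrite fh linear0.
have coordB k (u v : c0_sum X) : (u - v) k = u k - v k by [].
(* The gap is [rnorm x] minus the norm of [x] with its peak removed. It is positive because that
   second norm is itself attained at some coordinate. *)
have [d d0 x_le] : exists2 d, 0 < d & forall k, k != n -> rnorm (x k) + d <= rnorm x.
  pose z := x - c0_delta (x n).
  have zk k : k != n -> z k = x k.
    by move=> kn; rewrite coordB [c0_delta _ k]vdelta_out ?subr0// eq_sym.
  exists (rnorm x - rnorm z); last first.
    by move=> k kn; rewrite -zk// addrC -addrA gerDl addrC subr_le0 ler_rnorm_c0.
  rewrite subr_gt0; have [m -> _] := rnorm_c0_max z.
  have [->|mn] := eqVneq m n.
    by rewrite coordB [c0_delta _ n]vdelta_in subrr rnorm0 rnorm_gt0.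
  rewrite zk// lt_neqAle ler_rnorm_c0 andbT.
  by apply: contra_neq mn => xm; apply/peak.
have ny := rnorm_gt0 y0; pose t := d / rnorm y.
have t0 : 0 < t by rewrite divr_gt0.
have [c c1 cf] := unimodular_rotation (f y).
(* The size [t] keeps the perturbation within [d], and the phase [c] makes [f w] equal to
   [rnorm x + t * rnorm (f y)], which cannot exceed [rnorm x]. *)
pose w := x + (of_real F t * c) *: y.
have w_le : rnorm w <= rnorm x.
  apply: rnorm_c0_le => k.
  have -> : w k = x k + (of_real F t * c) *: y k by [].
  have [->|kn] := eqVneq k n; first by rewrite yn scaler0 addr0 ler_rnorm_c0.
  apply: le_trans (ler_rnormD _ _) _; apply: le_trans (x_le k kn); rewrite lerD2l.
  rewrite rnormZ realpart_normM c1 realpart1 mulr1 of_real_norm ?(ltW t0)// of_realK.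
  by rewrite /t mulrAC ler_pdivrMr// ler_pM2l// ler_rnorm_c0.
have fw : f w = of_real F (rnorm x + t * rnorm (f y)).
  have tcf : of_real F t * c * (f y : K) = of_real F (t * rnorm (f y)).
    by rewrite -mulrA cf [RHS]of_realM rnormE.
  by rewrite of_realD -tcf rnormE -fx fh linearD linearZ.
have := le_trans (f_le w) w_le.
have tf_ge0 : 0 <= t * rnorm (f y) := mulr_ge0 (ltW t0) (rnorm_ge0 _).
rewrite fw rnorm_of_real; last exact: addr_ge0 (rnorm_ge0 _) tf_ge0.
rewrite gerDl pmulr_rle0// => fy; apply: rnorm0_eq0.
by apply/le_anti; rewrite rnorm_ge0 andbT.
Qed.

(** A norming functional of [x] depends only on the [n]-th coordinate, so norming functionals of [x]
    and of [x n] correspond, with the same differences. *)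
Lemma D_c0_peak n x : x != 0 ->
  (forall k, rnorm (x k) = rnorm x <-> k = n) -> D x = D (x n).
Proof.
move=> x0 peak; have xn : rnorm (x n) = rnorm x by apply/peak.
have xn0 : x n != 0.
  by apply/eqP => xn'; have := rnorm_gt0 x0; rewrite -xn xn' rnorm0 ltxx.
have coord f y : norming x f -> f y = f (c0_delta (y n)).
  move=> xf; have [f_lin _ _] := xf; have [h fh] := linear_bundle f_lin.
  apply/eqP; rewrite -subr_eq0; apply/eqP.
  have -> : f y - f (c0_delta (y n)) = f (y - c0_delta (y n)) by rewrite fh linearB.
  apply: (norming_vanish_off_peak x0 peak xf).
  have -> : (y - c0_delta (y n)) n = y n - c0_delta (y n) n by [].
  by rewrite [c0_delta _ n]vdelta_in subrr.
have restrict f : norming x f -> norming (x n) (fun v => f (c0_delta v)).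
  move=> xf; have [f_lin f_le fx] := xf; split=> [a u v|v|].
  - by rewrite c0_delta_linear f_lin.
  - by rewrite -(rnorm_c0_delta v) f_le.
  - by rewrite -coord// fx -!rnormE xn.
apply/le_anti/andP; split; apply: D_le => //; try exact: D_ge0.
  move=> f g xf xg y; rewrite (coord _ _ xf) (coord _ _ xg).
  apply: le_trans (D_ge _ xn0 (restrict _ xf) (restrict _ xg)) _.
  by apply: ler_wpM2l; [exact: D_ge0|exact: ler_rnorm_c0].
move=> f g xf xg v.
have := D_ge (c0_delta v) x0 (norming_coord xn xf) (norming_coord xn xg).
by rewrite /= rnorm_c0_delta vdelta_in.
Qed.

Lemma D_c0_tie x : x != 0 ->
  ~ (exists n, forall k, rnorm (x k) = rnorm x <-> k = n) -> D x = 2.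
Proof.
move=> x0 no_peak; have [m xm _] := rnorm_c0_max x.
(* The maximum is attained at [m]; were it attained nowhere else, [m] would be a strict peak. *)
have [k [xk km]] : exists k, rnorm (x k) = rnorm x /\ k != m.
  apply: contrapT => no_k; apply: no_peak; exists m => k; split=> [xk|->//].
  by apply: contrapT => /eqP km; apply: no_k; exists k.
have [f mf] := norming_exists (x m); have [g kg] := norming_exists (x k).
pose y := c0_delta (x m) - c0_delta (x k).
have E j : y j = vdelta (x m) j - vdelta (x k) j by [].
have ym : y m = x m by rewrite E vdelta_in vdelta_out// subr0.
have yk : y k = - x k by rewrite E vdelta_in vdelta_out ?sub0r// eq_sym.
have nm : 0 < rnorm (x m) by rewrite -xm rnorm_gt0.
have y0 : y != 0.
  by apply/eqP => y0; move: nm; rewrite -ym y0 rnorm0 ltxx.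
apply: (D_eq2 x0 (norming_coord (esym xm) mf) (norming_coord xk kg) y0).
have [_ _ fm] := mf; have [g_lin _ gk] := kg; have [h gh] := linear_bundle g_lin.
(* The opposite signs of [y] at [m] and [k] make the two values add up, while [y] itself has norm at
   most [rnorm x]. *)
have -> : f (y m) - g (y k) = of_real F (2 * rnorm x).
  rewrite ym yk fm gh linearN -gh gk opprK -!rnormE -xm xk.
  by rewrite -of_realD mulr_natl mulr2n.
rewrite rnorm_of_real ?mulr_ge0 ?rnorm_ge0//.
rewrite ler_pM2l//; apply: rnorm_c0_le => j; rewrite E.
have [->|jm] := eqVneq j m.
  by rewrite vdelta_in vdelta_out// subr0 -xm.
rewrite vdelta_out 1?eq_sym// sub0r rnormN.
have := norms_vdelta (x k) j; rewrite /norms => ->.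
by case: ifP => _; rewrite ?xk// rnorm_ge0.
Qed.

End c0_coordinates.

Theorem theorem15 (R : realType) (F : scalar_kind)
    (X : nat -> normedModType (scalars R F))
    (X_nontrivial : forall n, exists v : X n, v != 0) :
  (forall x : l1_sum X, x != 0 ->
     ((forall n, x n != 0) -> D x = sup [set D (x n) | n in [set: nat]]) /\
     (~ (forall n, x n != 0) -> D x = 2)) /\
  (forall x : c0_sum X, x != 0 ->
     (forall n, (forall k, rnorm (x k) = rnorm x <-> k = n) ->
        D x = D (x n)) /\
     (~ (exists n, forall k, rnorm (x k) = rnorm x <-> k = n) -> D x = 2)).
Proof.
split=> x x0; split; first exact: D_l1_nonzero.
- move=> /existsNP[n /negP/negPn/eqP xn]; have [v v0] := X_nontrivial n.
  exact: D_l1_vanishing x0 xn v0.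
- by move=> n peak; exact: D_c0_peak.
- exact: D_c0_tie.
Qed.
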